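(* Let $\mathbb{F}_q$ be a finite field with $q$ elements and characteristic $p$, let $\psi$ be a non-trivial additive character of $\mathbb{F}_q$ (with values in $\mathbb{Q}(\zeta_p)$, $\zeta_p$ a primitive $p$-th root of unity), and set $\psi_m := \psi \circ \mathrm{Tr}_{\mathbb{F}_{q^m}/\mathbb{F}_q}$. Let $f, g \in \mathbb{F}_q[x]$ be coprime polynomials such that $f/g$ has a pole at $0$ and at infinity (i.e. $g(0)=0$ and $\deg f > \deg g$), and such that the order of every pole of $f/g$ is not divisible by $p$. Let $n$ be the number of distinct roots of $g$ in an algebraic closure of $\mathbb{F}_q$. For $m \ge 1$ put \[ S_m(f/g) := \sum_{\bar x \in \mathbb{F}_{q^m},\ g(\bar x) \neq 0} \psi_m\big(f(\bar x)/g(\bar x)\big), \qquad L(f/g, T) := \exp\Big(\sum_{m\ge 1} S_m(f/g)\frac{T^m}{m}\Big). \] Let $d_1, \dots, d_r$ be the degrees of the distinct monic irreducible polynomials over $\mathbb{F}_q$ dividing $g$. If $p > \deg(f) + n - 1$, then \[ L(f/g, T) \equiv \prod_{i=1}^r (1 - T^{d_i}) \pmod{\pi}, \qquad \pi := 1 - \zeta_p, \] the congruence being coefficientwise in $\mathbb{Z}[\zeta_p][T]$.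
   Context: It is known (and may be used) that under the stated hypotheses $L(f/g,T)$ is a polynomial in $T$ with coefficients in $\mathbb{Z}[\zeta_p]$ of degree $\deg(f)+n-1$. *)

(* Defs.v *)
From HB Require Import structures.
From mathcomp Require Import all_boot all_order all_fingroup all_algebra.
From mathcomp Require Import all_solvable all_field.

Set Implicit Arguments.
Unset Strict Implicit.
Unset Printing Implicit Defensive.

Import GRing.Theory.
Local Open Scope ring_scope.

Definition additive_character (F : finFieldType) (psi : F -> algC) : Prop :=
  psi 0 = 1 /\ {morph psi : x y / x + y >-> x * y}.

(* galTrace has values in E; fin_trace is the corresponding element of F,
   and the default 0 is never reached, see fin_traceE. *)
Definition fin_trace (F : finFieldType) (E : fieldExtType F)
    (x : finvect_type E) : F :=
  odflt 0 [pick t : F | t%:A == galTrace 1%VS {:finvect_type E}%VS x].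

Lemma fin_traceE (F : finFieldType) (E : fieldExtType F) (x : finvect_type E) :
  (fin_trace x)%:A = galTrace 1%VS {:finvect_type E}%VS x.
Proof.
rewrite /fin_trace; case: pickP => [t /eqP // | noT].
have galE : galois 1%VS {:finvect_type E}%VS by apply: finField_galois; exact: subvf.
by have /vlineP[t Dt] := mem_galTrace galE (memvf x); have := noT t; rewrite Dt eqxx.
Qed.

Definition exp_sum (F : finFieldType) (psi : F -> algC) (f g : {poly F})
    (E : fieldExtType F) : algC :=
  let fE := map_poly (in_alg (finvect_type E)) f in
  let gE := map_poly (in_alg (finvect_type E)) g in
  \sum_(x : finvect_type E | gE.[x] != 0) psi (fin_trace (fE.[x] / gE.[x])).

(* A formal power series is its coefficient sequence.  For a series a with
   a 0 = 0, the coefficient of T^k in exp(a) only involves the powers a^j with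
   j <= k, and in these only the terms of a of degree at most k. *)
Definition fps_exp (a : nat -> algC) (k : nat) : algC :=
  (\sum_(j < k.+1) (j`!%:R)^-1 *: (\poly_(i < k.+1) a i) ^+ j)`_k.

(* E m plays the role of the degree m extension of F, for m >= 1. *)
Definition Lfun (F : finFieldType) (E : nat -> fieldExtType F)
    (psi : F -> algC) (f g : {poly F}) : nat -> algC :=
  fps_exp (fun m => if m == 0%N then 0 else exp_sum psi f g (E m) / m%:R).

(* mup x h is the multiplicity of x as a root of h, and subtraction is
   truncated: the value is 0 where f / g has no pole. *)
Definition pole_order (F : finFieldType) (K : closedFieldType)
    (iota : {rmorphism F -> K}) (f g : {poly F}) (x : K) : nat :=
  (mup x (map_poly iota g) - mup x (map_poly iota f))%N.

Definition pole_order_infty (F : finFieldType) (f g : {poly F}) : nat :=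
  ((size f).-1 - (size g).-1)%N.

Definition in_Zadjoin (z x : algC) : Prop :=
  exists c : {poly int}, x = (map_poly intr c).[z].

Definition eq_mod_Zadjoin (z a x y : algC) : Prop :=
  [/\ in_Zadjoin z x, in_Zadjoin z y
    & exists2 c : algC, in_Zadjoin z c & x - y = a * c].

(* Main.v *)
(* Write q for the cardinality of F, and for a monic h over F let t(h) be the sum
   of f / g over the roots of h.  Then t is additive in h, so the Euler product of
   L(f / g, T) expands as the power series whose coefficient D_k is the sum of
   psi (t h) over the monic h of degree k coprime to g; it is recognised through
   its logarithmic derivative k D_k = S_1 D_(k-1) + ... + S_k D_0.  Each value of
   psi is a power of zeta, hence congruent to 1 modulo pi, so D_k is congruent to
   the number of monic h of degree k coprime to g.  By inclusion-exclusion this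
   number is the coefficient of T^k in prod_i (1 - T^(d_i)) / (1 - q T), and q is
   divisible by pi.  The congruence thus holds already between power series. *)
Require Import Defs.
From HB Require Import structures.
From mathcomp Require Import all_boot all_order all_fingroup all_algebra.
From mathcomp Require Import all_solvable all_field.
From mathcomp Require Import zify.

Set Implicit Arguments.
Unset Strict Implicit.
Unset Printing Implicit Defensive.

Import GRing.Theory.
Local Open Scope ring_scope.

(** * Exponentials of power series *)

(** A zero constant term makes ['X] divide [u], so ['X^j] divides [u ^+ j]. *)
Lemma coef_expr_lt0 (R : comNzRingType) (u : {poly R}) (i j : nat) :
  u`_0 = 0 -> (i < j)%N -> (u ^+ j)`_i = 0.
Proof.
move=> u0 ltij; have /factor_theorem[v ->] : root u 0 by rewrite /root horner_coef0 u0.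
by rewrite subr0 exprMn coefMXn ltij.
Qed.

Lemma eq_coef_expr (R : nzRingType) (u v : {poly R}) (n j : nat) :
    (forall i, (i <= n)%N -> u`_i = v`_i) ->
  forall i, (i <= n)%N -> (u ^+ j)`_i = (v ^+ j)`_i.
Proof.
move=> Euv; elim: j => [|j IHj] i lein; first by rewrite !expr0.
rewrite !exprS !coefM; apply: eq_bigr => l _; rewrite Euv ?IHj //.
  exact: leq_trans (leq_subr _ _) lein.
by rewrite (leq_trans _ lein) // -ltnS.
Qed.

(** [fps_exp] truncates the series and the exponential at the index of the wanted coefficient.
    Longer truncations change nothing, so one truncation can serve for several coefficients. *)
Lemma fps_exp_stable (a : nat -> algC) (n N M : nat) :
    a 0 = 0 -> (n <= N)%N -> (n <= M)%N ->
  (\sum_(j < N.+1) (j`!%:R)^-1 *: (\poly_(i < M.+1) a i) ^+ j)`_n = fps_exp a n.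
Proof.
move=> a0 leN leM; rewrite /fps_exp !coef_sum.
rewrite (big_ord_widen N.+1 (fun j =>
  (j`!%:R^-1 *: (\poly_(i < n.+1) a i) ^+ j)`_n)) ?ltnS //.
rewrite [RHS]big_mkcond; apply: eq_bigr => j _ /=.
rewrite !coefZ; case: ltnP => lt_nj.
  congr (_ * _); apply: (@eq_coef_expr _ _ _ n) => // i lein.
  by rewrite !coef_poly !ltnS lein (leq_trans lein leM).
by rewrite coef_expr_lt0 ?mulr0 // coef_poly.
Qed.

Lemma fps_exp0 (a : nat -> algC) : fps_exp a 0 = 1.
Proof. by rewrite /fps_exp big_ord1 expr0 coefZ coef1 fact0 mulr1 invr1. Qed.

(** This is the coefficient form of exp(a)' = a' exp(a). *)
Lemma fps_exp_rec (a : nat -> algC) (k : nat) : a 0 = 0 ->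
  k.+1%:R * fps_exp a k.+1
    = \sum_(i < k.+1) (i.+1%:R * a i.+1) * fps_exp a (k - i).
Proof.
move=> a0; pose A := \poly_(i < k.+2) a i.
pose B n := \sum_(j < n.+1) (j`!%:R)^-1 *: A ^+ j : {poly algC}.
have dB : (B k.+1)^`() = A^`() * B k.
  rewrite /B raddf_sum big_ord_recl /= expr0 derivZ derivC scaler0 add0r mulr_sumr.
  apply: eq_bigr => j _; rewrite derivZ deriv_exp -scalerAr -scaler_nat scalerA.
  rewrite /= /bump add1n /= factS natrM invfM mulrAC mulVf ?mul1r //.
  by rewrite Num.Theory.pnatr_eq0.
have ->: fps_exp a k.+1 = (B k.+1)`_k.+1 by [].
rewrite mulr_natl -coef_deriv dB coefM; apply: eq_bigr => i _.
rewrite coef_deriv coef_poly ltnS ltn_ord mulr_natl; congr (_ * _).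
by apply: fps_exp_stable; rewrite ?leq_subr // leqW // leq_subr.
Qed.

(** * Congruences in Z[zeta] *)

Lemma in_Zadjoin_int z (n : int) : in_Zadjoin z n%:~R.
Proof. by exists n%:P; rewrite map_polyC hornerC. Qed.

Lemma in_Zadjoin_gen z : in_Zadjoin z z.
Proof. by exists 'X; rewrite map_polyX hornerX. Qed.

Lemma in_ZadjoinD z x y : in_Zadjoin z x -> in_Zadjoin z y -> in_Zadjoin z (x + y).
Proof. by move=> [c ->] [d ->]; exists (c + d); rewrite rmorphD hornerD. Qed.

Lemma in_ZadjoinM z x y : in_Zadjoin z x -> in_Zadjoin z y -> in_Zadjoin z (x * y).
Proof. by move=> [c ->] [d ->]; exists (c * d); rewrite rmorphM hornerM. Qed.

Lemma in_ZadjoinN z x : in_Zadjoin z x -> in_Zadjoin z (- x).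
Proof. by move=> [c ->]; exists (- c); rewrite rmorphN hornerN. Qed.

Lemma in_ZadjoinX z x n : in_Zadjoin z x -> in_Zadjoin z (x ^+ n).
Proof. by move=> [c ->]; exists (c ^+ n); rewrite rmorphXn horner_exp. Qed.

Lemma in_Zadjoin_sum z (I : Type) (r : seq I) (P : pred I) (G : I -> algC) :
  (forall i, P i -> in_Zadjoin z (G i)) -> in_Zadjoin z (\sum_(i <- r | P i) G i).
Proof.
move=> ZG; elim/big_ind: _ => //; last by move=> x y; apply: in_ZadjoinD.
exact: (in_Zadjoin_int z 0).
Qed.

Section Congruence.

Variables z a : algC.

Lemma eq_mod_Zadjoin_refl x : in_Zadjoin z x -> eq_mod_Zadjoin z a x x.
Proof.
move=> Zx; split=> //; exists 0; first exact: (in_Zadjoin_int z 0).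
by rewrite subrr mulr0.
Qed.

Lemma eq_mod_Zadjoin_sym x y : eq_mod_Zadjoin z a x y -> eq_mod_Zadjoin z a y x.
Proof.
case=> Zx Zy [c Zc Dc]; split=> //; exists (- c); first exact: in_ZadjoinN.
by rewrite mulrN -Dc opprB.
Qed.

Lemma eq_mod_Zadjoin_trans y x w :
  eq_mod_Zadjoin z a x y -> eq_mod_Zadjoin z a y w -> eq_mod_Zadjoin z a x w.
Proof.
case=> Zx _ [c Zc Dc] [_ Zw [d Zd Dd]]; split=> //; exists (c + d).
  exact: in_ZadjoinD.
by rewrite mulrDr -Dc -Dd addrA subrK.
Qed.

Lemma eq_mod_ZadjoinD x y x' y' : eq_mod_Zadjoin z a x y ->
  eq_mod_Zadjoin z a x' y' -> eq_mod_Zadjoin z a (x + x') (y + y').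
Proof.
case=> Zx Zy [c Zc Dc] [Zx' Zy' [d Zd Dd]]; split; try exact: in_ZadjoinD.
by exists (c + d); rewrite ?mulrDr -?Dc -?Dd ?opprD 1?addrACA //; apply: in_ZadjoinD.
Qed.

Lemma eq_mod_Zadjoin_sum (I : Type) (r : seq I) (P : pred I) (G H : I -> algC) :
    (forall i, P i -> eq_mod_Zadjoin z a (G i) (H i)) ->
  eq_mod_Zadjoin z a (\sum_(i <- r | P i) G i) (\sum_(i <- r | P i) H i).
Proof.
move=> eqGH; elim/big_ind2: _ => //; last by move=> *; apply: eq_mod_ZadjoinD.
exact: eq_mod_Zadjoin_refl (in_Zadjoin_int z 0).
Qed.

End Congruence.

(** The quotient of [z ^+ n - 1] by [1 - z] is minus a geometric sum. *)
Lemma eq_mod_Zadjoin_expr z n : eq_mod_Zadjoin z (1 - z) (z ^+ n) 1.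
Proof.
have Zz := in_Zadjoin_gen z; have Z1 := in_Zadjoin_int z 1.
split=> //; first exact: in_ZadjoinX.
exists (- \sum_(i < n) z ^+ i).
  by apply/in_ZadjoinN/in_Zadjoin_sum => i _; apply: in_ZadjoinX.
by rewrite subrX1 -opprB mulrN mulNr.
Qed.

(** The powers [z ^+ i] with [i < p] sum to 0, and each of them is congruent to 1. *)
Lemma eq_mod_Zadjoin_prime p z : (1 < p)%N -> p.-primitive_root z ->
  eq_mod_Zadjoin z (1 - z) p%:R 0.
Proof.
move=> p_gt1 prim_z; have z_neq1: z != 1.
  by rewrite -[z]expr1 -(prim_order_dvd prim_z) dvdn1 gtn_eqF.
have <-: \sum_(i < p) z ^+ i = 0.
  apply: (mulfI (x := z - 1)); first by rewrite subr_eq0.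
  by rewrite -subrX1 prim_expr_order // subrr mulr0.
rewrite -[p in p%:R]card_ord -sumr_const.
by apply: eq_mod_Zadjoin_sum => i _; apply/eq_mod_Zadjoin_sym/eq_mod_Zadjoin_expr.
Qed.

Lemma eq_mod_Zadjoin_int p z (m n : int) : (1 < p)%N -> p.-primitive_root z ->
  (p %| m - n)%Z -> eq_mod_Zadjoin z (1 - z) m%:~R n%:~R.
Proof.
move=> p_gt1 prim_z /dvdzP[c Dc]; split; try exact: in_Zadjoin_int.
have [_ _ [d Zd Dd]] := eq_mod_Zadjoin_prime p_gt1 prim_z.
exists (c%:~R * d); first by apply: in_ZadjoinM => //; apply: in_Zadjoin_int.
by rewrite mulrCA -Dd subr0 -intrB Dc intrM.
Qed.

(** * Counting monic polynomials *)

Definition monics (F : finFieldType) (k : nat) : seq {poly F} :=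
  [seq 'X^k + rVpoly v | v : 'rV[F]_k].

Section Monics.

Variable F : finFieldType.
Implicit Types h N Q : {poly F}.

Lemma mem_monics k h : (h \in monics F k) = (h \is monic) && (size h == k.+1).
Proof.
apply/imageP/andP=> [[v _ ->] | [mon_h /eqP sz_h]].
  have szv: (size (rVpoly v) < size ('X^k : {poly F}))%N.
    by rewrite size_polyXn ltnS size_poly.
  by rewrite monicE lead_coefDl // lead_coefXn size_polyDl // size_polyXn.
exists (poly_rV (h - 'X^k)); first by [].
rewrite poly_rV_K; first by rewrite addrC subrK.
apply/leq_sizeP => j; rewrite leq_eqVlt coefB coefXn => /predU1P[<- | ltkj].
  by rewrite eqxx -[k]/(k.+1.-1) -sz_h -lead_coefE (monicP mon_h) subrr.
by rewrite gtn_eqF // subr0 nth_default // sz_h.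
Qed.

Lemma monics_uniq k : uniq (monics F k).
Proof.
rewrite map_inj_uniq ?enum_uniq // => u v /addrI Euv.
by rewrite -[u]rVpolyK Euv rVpolyK.
Qed.

Lemma size_monics k : size (monics F k) = (#|F| ^ k)%N.
Proof. by rewrite size_map -cardE card_mx mul1n. Qed.

Lemma perm_monics_dvd k N : N \is monic -> ((size N).-1 <= k)%N ->
  perm_eq [seq h <- monics F k | N %| h]
          [seq N * h | h <- monics F (k - (size N).-1)].
Proof.
move=> mon_N le_N; have N0 := monic_neq0 mon_N.
have szN: (0 < size N)%N by rewrite size_poly_gt0.
apply: uniq_perm; first by rewrite filter_uniq ?monics_uniq.
  by rewrite map_inj_uniq ?monics_uniq //; apply: mulfI.
move=> h; rewrite mem_filter mem_monics; apply/and3P/mapP => [[] | [h']].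
  move=> /dvdpP[h' ->]; rewrite mulrC monicMl // => mon_h'.
  rewrite size_monicM ?monic_neq0 // => /eqP sz; exists h' => //.
  rewrite mem_monics mon_h' /=; apply/eqP; move: (size N) (size h') szN le_N sz => n m.
  by lia.
rewrite mem_monics => /andP[mon_h' /eqP sz] ->.
split; [exact: dvdp_mulr | by rewrite monicMl |].
rewrite size_monicM ?monic_neq0 // sz; apply/eqP.
by move: (size N) szN le_N => n; lia.
Qed.

Lemma sum_monics_dvd (V : nmodType) (G : {poly F} -> V) k N : N \is monic ->
  \sum_(h <- monics F k | N %| h) G h
    = if ((size N).-1 <= k)%N then \sum_(h <- monics F (k - (size N).-1)) G (N * h)
      else 0.
Proof.
move=> mon_N; case: leqP => [le_N | lt_N].
  by rewrite -big_filter (perm_big _ (perm_monics_dvd mon_N le_N)) big_map.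
rewrite big_seq_cond big_pred0 // => h; rewrite mem_monics.
apply/negP => /andP[/andP[mon_h /eqP sz_h] /dvdp_leq].
by rewrite monic_neq0 // sz_h => /(_ isT) leN; move: (size N) lt_N leN => n; lia.
Qed.

Lemma monic_irreducible_dvd Q N : Q \is monic -> N \is monic ->
  irreducible_poly Q -> irreducible_poly N -> (Q %| N) = (Q == N).
Proof.
move=> mon_Q mon_N irr_Q irr_N; apply/idP/eqP => [/irr_N | ->] //.
by rewrite gtn_eqF ?irr_Q.1 // => /(_ isT); rewrite eqp_monic // => /eqP.
Qed.

Lemma natr_card_finField : #|F|%:R = 0 :> F.
Proof.
have [p _ charFp] := finPcharP F; have F_gt1 := finNzRing_gt1 F.
apply/eqP; rewrite -(dvdn_pcharf charFp); move: F_gt1.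
by rewrite (card_pprimeChar charFp); case: (logn _ _) => // n _; apply: dvdn_exp.
Qed.

(* Inclusion-exclusion; the main terms q^j vanish in F unless j = 0. *)
Lemma count_monics_ndvd (s : seq {poly F}) k : uniq s ->
    (forall Q, Q \in s -> Q \is monic /\ irreducible_poly Q) ->
  (count (fun h => all (fun Q => ~~ (Q %| h)) s) (monics F k))%:R
    = (\prod_(Q <- s) (1 - 'X^((size Q).-1)))`_k :> F.
Proof.
rewrite -sum1_count natr_sum.
elim: s k => [|Q s IHs] k /=.
  move=> _ _; rewrite big_nil coef1 -natr_sum sum1_size size_monics natrX.
  by rewrite natr_card_finField expr0n.
case/andP=> Q_s uniq_s irr_s; have [mon_Q irr_Q] := irr_s Q (mem_head _ _).
have{}irr_s N : N \in s -> N \is monic /\ irreducible_poly N.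
  by move=> s_N; apply: irr_s; rewrite inE s_N orbT.
(* Distinct monic irreducible polynomials are coprime, so a factor [Q] does not affect divisibility
   by the members of [s]. *)
have all_mulQ h : all (fun N => ~~ (N %| Q * h)) s = all (fun N => ~~ (N %| h)) s.
  apply: eq_in_all => N s_N; have [mon_N irr_N] := irr_s N s_N.
  rewrite Gauss_dvdpr // irreducible_poly_coprime // monic_irreducible_dvd //.
  by apply: contraNneq Q_s => <-.
rewrite big_cons mulrBl mul1r coefB coefXnM -!IHs //.
(* Among the [h] avoiding [s], the multiples of [Q] are the [Q * h'] with [h'] avoiding [s]; they
   account for the subtracted coefficient, which is 0 when [Q] has degree above [k]. *)
rewrite [in RHS](bigID (fun h => Q %| h)) /=.
under [X in _ = X + _ - _]eq_bigl do rewrite andbC.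
rewrite [X in _ = X + _ - _]big_mkcondr sum_monics_dvd // ltnNge.
under [X in _ = _ + X - _]eq_bigl do rewrite andbC.
rewrite addrAC; case: leqP => _ /=; last by rewrite subr0 add0r.
by under [X in _ = X - _ + _]eq_bigr do rewrite all_mulQ; rewrite -big_mkcond subrr add0r.
Qed.

End Monics.

(** * Frobenius orbits of roots *)

Section Frobenius.

Variables (F : finFieldType) (K : closedFieldType) (iota : {rmorphism F -> K}).

(* The phantom argument makes frob iota the key of the ring morphism instances,
   which need the characteristic of K. *)
Definition frob of {rmorphism F -> K} : K -> K := fun x => x ^+ #|F|.
Local Notation fr := (frob iota).

Lemma frob_zmod_morphism : zmod_morphism fr.
Proof.
have [p _ charF] := finPcharP F.
have natq : [pchar K].-nat #|F|.
  rewrite (eq_pnat _ (fmorph_pchar iota)) (card_pprimeChar charF) pnatX.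
  by rewrite pnatE ?charF ?orbT //; case/andP: charF.
move=> x y; rewrite /frob exprDn_pchar //; congr (_ + _).
apply: (addIr (y ^+ #|F|)); rewrite -exprDn_pchar // !addNr expr0n.
by rewrite gtn_eqF // (ltn_trans _ (finNzRing_gt1 F)).
Qed.

Lemma frob_monoid_morphism : monoid_morphism fr.
Proof. by split=> [|x y]; rewrite /frob ?expr1n ?exprMn. Qed.

HB.instance Definition _ := GRing.isZmodMorphism.Build K K fr frob_zmod_morphism.
HB.instance Definition _ := GRing.isMonoidMorphism.Build K K fr frob_monoid_morphism.

Lemma frob_iota c : fr (iota c) = iota c.
Proof. by rewrite /frob -rmorphXn expf_card. Qed.

Lemma iter_frob i x : iter i fr x = x ^+ (#|F| ^ i).
Proof. by elim: i => [|i IHi]; rewrite ?expn0 // iterS IHi /frob -exprM -expnSr. Qed.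

Lemma map_frob_iota (h : {poly F}) : map_poly fr (map_poly iota h) = map_poly iota h.
Proof. by rewrite -map_poly_comp; apply: eq_map_poly => c /=; apply: frob_iota. Qed.

(** A fixed point is a root of X^q - X, which already splits over [F] into the factors X - c. *)
Lemma frob_fixed x : fr x = x -> exists c, iota c = x.
Proof.
move=> fix_x; have: (map_poly iota ('X^#|F| - 'X)).[x] = 0.
  rewrite rmorphB /= map_polyXn map_polyX hornerD hornerN hornerXn hornerX.
  by rewrite [x ^+ _]fix_x subrr.
rewrite finField_genPoly rmorph_prod /= horner_prod => /eqP/prodf_eq0[c _].
rewrite rmorphB /= map_polyX map_polyC hornerXsubC subr_eq0 => /eqP->.
by exists c.
Qed.

Definition iota_inv (x : K) : F := odflt 0 [pick c | iota c == x].

Lemma iotaK : cancel iota (iota_inv).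
Proof.
move=> c; rewrite /iota_inv; case: pickP => [b /eqP/fmorph_inj // | /(_ c)].
by rewrite eqxx.
Qed.

Lemma iota_invK x : fr x = x -> iota (iota_inv x) = x.
Proof. by case/frob_fixed=> c <-; rewrite iotaK. Qed.

(** Descent to [F]. As [iota_inv] is not a ring morphism, the coefficients are treated one at a
    time. *)
Lemma frob_fixed_poly (u : {poly K}) : map_poly fr u = u ->
  map_poly iota (map_poly (iota_inv) u) = u.
Proof.
move=> fix_u; apply/polyP=> i; rewrite coef_map /= coef_poly.
case: ltnP => [_ | leui]; first by rewrite iota_invK // -[in RHS]fix_u coef_map.
by rewrite rmorph0 nth_default.
Qed.

(** Roots are listed with multiplicity in an unspecified order, hence the statements up to [perm_eq]
    below. *)
Definition roots_of (h : {poly F}) : seq K :=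
  sval (closed_field_poly_normal (map_poly iota h)).

Lemma roots_ofP h : h \is monic ->
  map_poly iota h = \prod_(z <- roots_of h) ('X - z%:P).
Proof.
move=> mon_h; rewrite /roots_of; case: closed_field_poly_normal => /= r.
by rewrite (monicP (monic_map iota mon_h)) scale1r.
Qed.

Lemma mem_roots_of h z : h \is monic ->
  (z \in roots_of h) = root (map_poly iota h) z.
Proof. by move=> mon_h; rewrite roots_ofP // root_prod_XsubC. Qed.

Lemma size_roots_of h : h \is monic -> size h = (size (roots_of h)).+1.
Proof. by move=> mon_h; rewrite -(size_map_poly iota) roots_ofP // size_prod_XsubC. Qed.

Lemma roots_of_perm h r : h \is monic ->
  map_poly iota h = \prod_(z <- r) ('X - z%:P) -> perm_eq (roots_of h) r.
Proof. by move=> mon_h Dh; apply: prod_XsubC_eq; rewrite -roots_ofP. Qed.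

Lemma roots_ofM h1 h2 : h1 \is monic -> h2 \is monic ->
  perm_eq (roots_of (h1 * h2)) (roots_of h1 ++ roots_of h2).
Proof.
move=> mon1 mon2; apply: roots_of_perm; first by rewrite monicMl.
by rewrite rmorphM /= !roots_ofP // big_cat.
Qed.

(** Frobenius fixes the coefficients of [h], so it permutes the roots and preserves
    multiplicities. *)
Lemma roots_of_frob h : h \is monic ->
  perm_eq (roots_of h) [seq fr z | z <- roots_of h].
Proof.
move=> mon_h; apply: roots_of_perm => //.
by rewrite -map_frob_iota roots_ofP // map_prod_XsubC big_map.
Qed.

Lemma iter_frob_roots_of h y i : h \is monic ->
  y \in roots_of h -> iter i fr y \in roots_of h.
Proof.
move=> mon_h hy; elim: i => //= i IHi.
by rewrite (perm_mem (roots_of_frob mon_h)) map_f.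
Qed.

Lemma iter_frob_inj n : injective (iter n fr).
Proof. by elim: n => // n IHn x y /(fmorph_inj fr)/IHn. Qed.

Lemma frob_iterB m n y : (m <= n)%N -> iter n fr y = iter m fr y ->
  iter (n - m) fr y = y.
Proof.
by move=> lemn Eny; apply: (@iter_frob_inj m); rewrite -iterD subnKC.
Qed.

(* If y ^ (q ^ i) = y, this is the power of degree i of the minimal polynomial
   of y over F. *)
Definition frob_norm (i : nat) (y : K) : {poly F} :=
  map_poly (iota_inv) (\prod_(z <- traject fr y i) ('X - z%:P)).

(** Since the [i]-th iterate returns to [y], Frobenius only rotates the list of factors; the product
    is therefore fixed and descends to [F]. *)
Lemma frob_normE i y : iter i fr y = y ->
  map_poly iota (frob_norm i y) = \prod_(z <- traject fr y i) ('X - z%:P).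
Proof.
move=> fix_y; apply: frob_fixed_poly; rewrite map_prod_XsubC.
have ->: \prod_(z <- traject fr y i) ('X - (fr z)%:P)
       = \prod_(z <- traject fr (fr y) i) ('X - z%:P).
  by elim: i {fix_y} (y) => [|j IHj] x; rewrite ?big_nil // trajectS !big_cons IHj.
case: i fix_y => [|i] fix_y; first by rewrite !big_nil.
rewrite trajectSr -iterSr fix_y trajectS; apply: perm_big.
by rewrite perm_rcons.
Qed.

Lemma frob_norm_monic i y : iter i fr y = y -> frob_norm i y \is monic.
Proof.
move=> fix_y; rewrite monicE -(inj_eq (@fmorph_inj _ _ iota)) -lead_coef_map.
by rewrite frob_normE // rmorph1 -monicE monic_prod_XsubC.
Qed.

Lemma size_frob_norm i y : iter i fr y = y -> size (frob_norm i y) = i.+1.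
Proof.
by move=> fix_y; rewrite -(size_map_poly iota) frob_normE // size_prod_XsubC size_traject.
Qed.

Lemma roots_of_frob_norm i y : iter i fr y = y ->
  perm_eq (roots_of (frob_norm i y)) (traject fr y i).
Proof. by move=> fix_y; rewrite roots_of_perm ?frob_norm_monic ?frob_normE. Qed.

Lemma frob_normD i j y : iter i fr y = y -> iter j fr y = y ->
  frob_norm (i + j) y = frob_norm i y * frob_norm j y.
Proof.
move=> fix_i fix_j; apply: (map_poly_inj iota).
by rewrite rmorphM /= !frob_normE ?iterD ?fix_j // trajectD fix_i big_cat.
Qed.

Lemma frob_norm_dvd_root i y h : h \is monic -> iter i.+1 fr y = y ->
  frob_norm i.+1 y %| h -> y \in roots_of h.
Proof.
move=> mon_h fix_y; rewrite -(dvdp_map iota) frob_normE // mem_roots_of //.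
by rewrite trajectS big_cons -dvdp_XsubCl => /(dvdp_trans (dvdp_mulr _ (dvdpp _))).
Qed.

(** The orbit of [y] stays among the finitely many roots of [h], so it loops, and injectivity of
    Frobenius brings the loop back to [y] itself. The least period is [d.+1]. *)
Lemma min_frob_period h y : h \is monic -> y \in roots_of h ->
  exists d, [/\ iter d.+1 fr y = y, forall i, iter i.+1 fr y = y -> (d <= i)%N
    & uniq (traject fr y d.+1)].
Proof.
move=> mon_h hy; have ex_d: exists d, iter d.+1 fr y == y.
  have: looping fr y (size (roots_of h)).
    apply: contraT; rewrite -looping_uniq => /(@uniq_leq_size _ _ (roots_of h)).
    rewrite size_traject ltnn; apply=> z /trajectP[j _ ->].
    exact: iter_frob_roots_of.
  case/loopingP/(_ (size (roots_of h)))/trajectP=> m ltm /(frob_iterB (ltnW ltm)).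
  by exists (size (roots_of h) - m).-1; rewrite prednK ?subn_gt0 //; apply/eqP.
case: (ex_minnP ex_d) => d /eqP fix_d min_d; exists d; split=> //.
  by move=> i fix_i; apply: min_d; apply/eqP.
rewrite looping_uniq; apply/negP=> /loopingP/(_ d)/trajectP[m ltmd].
move/(frob_iterB (ltnW ltmd)) => fix_m; have := min_d (d - m).-1.
rewrite prednK ?subn_gt0 // fix_m eqxx => /(_ isT); rewrite leqNgt => /negP[].
by rewrite prednK ?subn_gt0 // leq_subr.
Qed.

(* A divisor frob_norm i y of h is a power of the minimal polynomial of y, so the
   number of these divisors is the multiplicity of y in h. *)
Lemma sum_frob_norm_dvd y h k : h \is monic -> (size h <= k.+1)%N ->
  (\sum_(i < k) ((iter i.+1 fr y == y) && (frob_norm i.+1 y %| h)%R))%N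
    = count_mem y (roots_of h).
Proof.
(* Strong induction on [k]: dividing [h] by the minimal polynomial of [y] lowers the bound by the
   period. *)
elim: k {-2}k (leqnn k) h => [|n IHn] k le_kn h mon_h sz_h.
  move: le_kn sz_h; rewrite leqn0 => /eqP->.
  by rewrite size_roots_of // ltnS leqn0 size_eq0 => /eqP->; rewrite big_ord0.
have [hy | h'y] := boolP (y \in roots_of h); last first.
  rewrite (count_memPn h'y) big1 // => i _; apply/eqP; rewrite eqb0.
  apply: contra h'y => /andP[/eqP fix_y]; exact: frob_norm_dvd_root.
have [d [fix_d min_d uniq_d]] := min_frob_period mon_h hy.
(* Over one least period the conjugates of [y] are distinct roots of [h]. *)
have /dvdpP[h1 Dh] : frob_norm d.+1 y %| h.
  rewrite -(dvdp_map iota) frob_normE //; apply: uniq_roots_dvdp.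
    apply/allP=> z /trajectP[i _ ->]; rewrite -mem_roots_of //.
    exact: iter_frob_roots_of.
  by rewrite uniq_rootsE.
have monP := frob_norm_monic fix_d; rewrite mulrC in Dh.
have mon_h1 : h1 \is monic by rewrite -(monicMl _ monP) -Dh.
have sz_dh : size h = (d.+1 + size h1)%N.
  by rewrite Dh size_monicM ?monic_neq0 // size_frob_norm.
have h1_gt0 : (0 < size h1)%N by rewrite size_poly_gt0 monic_neq0.
have le_dk : (d.+1 <= k)%N.
  by rewrite -ltnS (leq_trans _ sz_h) // sz_dh -addn1 leq_add2l.
(* The terms with [i < d] vanish by minimality, [i = d] contributes 1, and the later ones, shifted
   by [d.+1], are the terms for [h1]. *)
rewrite -(subnKC le_dk) big_split_ord big_ord_recr /= [fr _]fix_d eqxx Dh dvdp_mulr //=.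
rewrite big1 => [|i _]; last first.
  apply/eqP; rewrite eqb0; apply: contraL (ltn_ord i) => /andP[/eqP/min_d].
  by rewrite -leqNgt.
rewrite (seq.permP (roots_ofM monP mon_h1)) count_cat (seq.permP (roots_of_frob_norm fix_d)).
rewrite count_uniq_mem // mem_head -(IHn (k - d.+1)%N) //.
- congr addn; apply: eq_bigr => i _; rewrite -iterS -addnS iterD.
  have ->: (iter d.+1 fr (iter i.+1 fr y) == y) = (iter i.+1 fr y == y).
    by rewrite -{2}fix_d (inj_eq (@iter_frob_inj d.+1)).
  case: eqP => //= fix_i.
  by rewrite -addnS frob_normD // dvdp_mul2l // monic_neq0.
- by rewrite leq_subLR (leq_trans le_kn) // addSn ltnS leq_addl.
- by rewrite -subSn // leq_subRL -?sz_dh // ltnW.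
Qed.

End Frobenius.

(** * Finite extensions inside the algebraic closure *)

(** [L] is generated over [F] by a separable element [z]; the embedding sends [z] to a root in [K]
    of its minimal polynomial. *)
Lemma exists_embedding (F : finFieldType) (K : closedFieldType)
    (iota : {rmorphism F -> K}) (L : splittingFieldType F) :
  exists phi : {rmorphism L -> K}, forall c : F, phi c%:A = iota c.
Proof.
have /and3P[_ sepL _] : galois 1 {:L}%AS by apply: finField_galois; apply: subvf.
pose z := separable_generator 1 {:L}.
have defL : <<1; z>>%VS = {:L}%VS by rewrite -eq_adjoin_separable_generator ?sub1v.
have /polyOver1P[P DP] := minPolyOver 1%AS z.
have [alpha P_alpha] : exists alpha, root (map_poly iota P) alpha.
  apply/closed_rootP; rewrite size_map_poly -(size_map_poly (in_alg L)) -DP.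
  by rewrite size_minPoly.
have rep_exists u : exists h : {poly F}, (map_poly (in_alg L) h).[z] == u.
  have /polyOver1P[h Dh] := Fadjoin_polyOver 1%AS z u.
  by exists h; rewrite -Dh Fadjoin_poly_eq // defL memvf.
pose rep u := xchoose (rep_exists u).
have repE u : (map_poly (in_alg L) (rep u)).[z] = u := eqP (xchooseP (rep_exists u)).
pose phi u := (map_poly iota (rep u)).[alpha].
(* The value at [alpha] is independent of the polynomial representing [u], as two choices differ by
   a multiple of [P]. Compatibility with the ring operations follows. *)
have phiE h u : (map_poly (in_alg L) h).[z] = u -> phi u = (map_poly iota h).[alpha].
  move=> Du; apply/eqP; rewrite -subr_eq0 -hornerN -hornerD -rmorphB /=.
  have /dvdpP[c ->] : P %| rep u - h.
    rewrite -(dvdp_map (in_alg L)) -DP minPoly_dvdp //.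
      by apply/polyOver1P; exists (rep u - h).
    by rewrite rootE rmorphB /= hornerD hornerN repE Du subrr.
  by rewrite rmorphM /= hornerM (rootP P_alpha) mulr0.
have phiB : zmod_morphism phi.
  move=> u v; rewrite (phiE (rep u - rep v)).
    by rewrite rmorphB /= hornerD hornerN.
  by rewrite rmorphB /= hornerD hornerN !repE.
have phiM : monoid_morphism phi.
  split=> [|u v]; first by rewrite (phiE 1) ?rmorph1 ?hornerC.
  rewrite (phiE (rep u * rep v)); first by rewrite rmorphM /= hornerM.
  by rewrite rmorphM /= hornerM !repE.
pose phiBm := GRing.isZmodMorphism.Build _ _ phi phiB.
pose phiMm := GRing.isMonoidMorphism.Build _ _ phi phiM.
exists (HB.pack phi phiBm phiMm : {rmorphism L -> K}) => c /=.
by rewrite (phiE c%:P) map_polyC hornerC.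
Qed.

(** The Galois group is cyclic of order the degree, generated by the q-th power map. *)
Lemma galTrace_finField (F : finFieldType) (L : splittingFieldType F) (w : L) :
  galTrace 1 {:L} w = \sum_(j < \dim {:L}) w ^+ (#|F| ^ j).
Proof.
have [a /eqP gen_a Da] := finField_galois_generator (sub1v {:L}%AS).
have gal1L : galois 1 {:L}%AS by apply: finField_galois; apply: sub1v.
have aX j x : (a ^+ j)%g x = x ^+ (#|F| ^ j).
  elim: j => [|j IHj]; first by rewrite gal_id.
  by rewrite expgSr galM ?memvf // IHj Da ?memvf // dimv1 expn1 expnSr exprM.
have ord_a : #[a]%g = \dim {:L}.
  by rewrite orderE -gen_a -galois_dim // dimv1 divn1.
rewrite /galTrace gen_a -ord_a.
have ->: <[a]>%g = [set (a ^+ (val j))%g | j : 'I_#[a]%g].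
  apply/setP=> x; apply/idP/imsetP=> [/cyclePmin[j ltj ->] | [j _ ->]].
    by exists (Ordinal ltj).
  exact: mem_cycle.
rewrite big_imset /=; first by apply: eq_bigr => j _; apply: aX.
move=> i j _ _ /eqP; rewrite eq_expg_mod_order !modn_small // => /eqP.
exact: val_inj.
Qed.

Section FiniteExtension.

Variables (F : finFieldType) (K : closedFieldType) (iota : {rmorphism F -> K}).
Variables (E : fieldExtType F) (phi : {rmorphism finvect_type E -> K}).
Hypothesis phiA : forall c : F, phi c%:A = iota c.
Local Notation fr := (frob iota).

Lemma card_finvect_type : #|{: finvect_type E}| = (#|F| ^ \dim {:E})%N.
Proof. by rewrite -(card_vspacef (Vector.class (finvect_type E))) card_vspace. Qed.

(** Both conditions say that [y] is a root of X^N - X, where N is the cardinality of [E]. *)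
Lemma mem_embedding_image y :
  (y \in [seq phi x | x : finvect_type E]) = (iter (\dim {:E}) fr y == y).
Proof.
rewrite iter_frob -card_finvect_type; apply/imageP/eqP => [[x _ ->] | fix_y].
  by rewrite -rmorphXn expf_card.
have: (map_poly phi ('X^#|{: finvect_type E}| - 'X)).[y] = 0.
  rewrite rmorphB /= map_polyXn map_polyX hornerD hornerN hornerXn hornerX.
  by rewrite fix_y subrr.
rewrite finField_genPoly rmorph_prod /= horner_prod => /eqP/prodf_eq0[x _].
rewrite rmorphB /= map_polyX map_polyC hornerXsubC subr_eq0 => /eqP->.
by exists x.
Qed.

Lemma fin_trace_embedding (w : finvect_type E) :
  iota (fin_trace w) = \sum_(z <- traject fr (phi w) (\dim {:E})) z.
Proof.
rewrite -phiA fin_traceE galTrace_finField rmorph_sum /=.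
rewrite [RHS](big_nth (phi w)) size_traject big_mkord; apply: eq_bigr => j _.
by rewrite nth_traject // iter_frob rmorphXn.
Qed.

End FiniteExtension.

(** * The L-function *)

Lemma sum_count_mem_undup (T : eqType) (r : seq T) :
  (\sum_(y <- undup r) count_mem y r)%N = size r.
Proof.
rewrite -sum1_size -[RHS](big_undup_iterop_count addn).
by apply: eq_bigr => y _; rewrite Monoid.iteropE iter_addn mul1n addn0.
Qed.

Section RationalFunction.

Variables (F : finFieldType) (K : closedFieldType) (iota : {rmorphism F -> K}).
Variables f g : {poly F}.
Local Notation fr := (frob iota).
Local Notation roots_of := (roots_of iota).
Local Notation frob_norm := (frob_norm iota).

Definition rat_eval (y : K) : K :=
  (map_poly iota f).[y] / (map_poly iota g).[y].

Lemma rat_eval_frob y : fr (rat_eval y) = rat_eval (fr y).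
Proof. by rewrite /rat_eval fmorph_div /= -!horner_map /= !map_frob_iota. Qed.

Lemma sum_traject_rat_eval i y :
  \sum_(z <- traject fr (rat_eval y) i) z = \sum_(z <- traject fr y i) rat_eval z.
Proof.
elim: i y => [|i IHi] y; first by rewrite !big_nil.
by rewrite !trajectS !big_cons rat_eval_frob IHi.
Qed.

(** This is t(h). The inner sum is invariant under Frobenius for monic [h], so the default of
    [iota_inv] is not reached; roots of [g] contribute 0 by the convention for division by zero. *)
Definition root_trace (h : {poly F}) : F :=
  iota_inv iota (\sum_(z <- roots_of h) rat_eval z).

Lemma root_traceE h : h \is monic ->
  iota (root_trace h) = \sum_(z <- roots_of h) rat_eval z.
Proof.
move=> mon_h; apply: iota_invK; rewrite rmorph_sum /=.
rewrite [RHS](perm_big _ (roots_of_frob iota mon_h)) big_map.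
by apply: eq_bigr => z _; apply: rat_eval_frob.
Qed.

Lemma root_traceM h1 h2 : h1 \is monic -> h2 \is monic ->
  root_trace (h1 * h2) = root_trace h1 + root_trace h2.
Proof.
move=> mon1 mon2; apply: (fmorph_inj iota); rewrite rmorphD /=.
rewrite !root_traceE ?monicMl // (perm_big _ (roots_ofM iota mon1 mon2)).
by rewrite big_cat.
Qed.

(** As [g] has coefficients in [F], it vanishes at all Frobenius conjugates of [y] or at none. *)
Lemma coprimep_frob_norm i y : iter i.+1 fr y = y ->
  coprimep (frob_norm i.+1 y) g = ((map_poly iota g).[y] != 0).
Proof.
move=> fix_y; rewrite -(coprimep_map iota) frob_normE //.
apply/Pdiv.ClosedField.coprimepP/idP => [|g_y z].
  by apply; rewrite root_prod_XsubC trajectS mem_head.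
rewrite root_prod_XsubC => /trajectP[j _ ->].
elim: j => //= j IHj; rewrite -map_frob_iota horner_map.
by rewrite fmorph_eq0.
Qed.

(** The trace from [E] to [F] sums over [i.+1] successive Frobenius conjugates, and these are the
    roots of the norm polynomial. *)
Lemma exp_sum_embedding (psi : F -> algC) (E : fieldExtType F)
    (phi : {rmorphism finvect_type E -> K}) i :
    (forall c : F, phi c%:A = iota c) -> \dim {:E} = i.+1 ->
  exp_sum psi f g E =
    \sum_(y <- [seq phi x | x : finvect_type E] | coprimep (frob_norm i.+1 y) g)
      psi (root_trace (frob_norm i.+1 y)).
Proof.
move=> phiA dimE; have phi_horner h x :
    phi (map_poly (in_alg (finvect_type E)) h).[x] = (map_poly iota h).[phi x].
  rewrite -horner_map -map_poly_comp; congr _.[_].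
  by apply: eq_map_poly => c /=; apply: phiA.
have fix_phi x : iter i.+1 fr (phi x) = phi x.
  by apply/eqP; rewrite -dimE -(mem_embedding_image iota phi) image_f.
rewrite big_image_cond /exp_sum; apply: eq_big => [x | x _].
  by rewrite coprimep_frob_norm // -phi_horner fmorph_eq0.
congr psi; apply: (fmorph_inj iota).
rewrite (fin_trace_embedding phiA) root_traceE ?frob_norm_monic // dimE.
rewrite (perm_big _ (roots_of_frob_norm (fix_phi x))) -sum_traject_rat_eval.
by rewrite fmorph_div !phi_horner.
Qed.

(** Any [y] whose norm divides [h] is a root of [h], so the count over the field can be restricted
    to the distinct roots of [h]. *)
Lemma sum_embedding_dvd (E : fieldExtType F)
    (phi : {rmorphism finvect_type E -> K}) i h :
    (forall c : F, phi c%:A = iota c) -> \dim {:E} = i.+1 -> h \is monic ->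
  (\sum_(y <- [seq phi x | x : finvect_type E]) (frob_norm i.+1 y %| h)%R
    = \sum_(y <- undup (roots_of h))
        ((iter i.+1 fr y == y) && (frob_norm i.+1 y %| h)%R))%N.
Proof.
move=> phiA dimE mon_h; rewrite -!big_mkcond /= !sum1_count -!size_filter.
apply/perm_size/uniq_perm; rewrite ?filter_uniq ?undup_uniq //.
  by rewrite map_inj_uniq ?enum_uniq //; apply: fmorph_inj.
move=> y; rewrite !mem_filter mem_undup (mem_embedding_image iota) dimE.
rewrite andbC; case: eqP => //= fix_y; case dv: (_ %| h) => //=.
by rewrite (frob_norm_dvd_root mon_h fix_y dv).
Qed.

Section CharacterSums.

Variable psi : F -> algC.
Hypothesis psiD : {morph psi : x y / x + y >-> x * y}.

Definition divisor_sum (k : nat) : algC :=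
  \sum_(h <- monics F k | coprimep h g) psi (root_trace h).

Variables (E : nat -> fieldExtType F)
  (dimE : forall m : nat, (0 < m)%N -> \dim {:E m} = m).

(* The logarithmic derivative of the Euler product: comparing it with the
   exponential only uses that every monic h of degree k is divisible by exactly k
   of the norms of elements y of the fields E i, 0 < i <= k. *)
Lemma divisor_sum_rec k :
  k.+1%:R * divisor_sum k.+1
    = \sum_(i < k.+1) exp_sum psi f g (E i.+1) * divisor_sum (k - i).
Proof.
pose G h := if coprimep h g then psi (root_trace h) else 0.
have /fin_all_exists[phi phiA] (i : 'I_k.+1) :
    exists phi : {rmorphism finvect_type (E i.+1) -> K},
      forall c : F, phi c%:A = iota c by exact: exists_embedding.
pose X (i : 'I_k.+1) := [seq phi i x | x : finvect_type (E i.+1)].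
have fixX (i : 'I_k.+1) y : y \in X i -> iter i.+1 fr y = y.
  by rewrite (mem_embedding_image iota) dimE // => /eqP.
(* Double counting of the triples [h], [i], [y] where the norm of [y] divides [h]. For fixed [h]
   there are as many as roots with multiplicity, that is [k.+1]. *)
transitivity (\sum_(h <- monics F k.+1) \sum_(i < k.+1)
    \sum_(y <- X i) (frob_norm i.+1 y %| h)%R%:R * G h).
  rewrite /divisor_sum big_mkcond mulr_sumr big_seq [RHS]big_seq.
  apply: eq_bigr => h; rewrite mem_monics => /andP[mon_h /eqP sz_h].
  under eq_bigr do rewrite -mulr_suml -natr_sum.
  rewrite -mulr_suml -natr_sum; congr (_%:R * _).
  under eq_bigr => i _ do
    rewrite (sum_embedding_dvd (phiA i)) ?dimE //.
  rewrite exchange_big /=.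
  under eq_bigr do rewrite sum_frob_norm_dvd ?sz_h //.
  rewrite sum_count_mem_undup; apply: succn_inj.
  by rewrite -size_roots_of // sz_h.
rewrite exchange_big; apply: eq_bigr => i _; rewrite exchange_big /=.
rewrite (exp_sum_embedding _ (phiA i) (dimE (ltn0Sn i))) mulr_suml.
rewrite [RHS]big_mkcond big_seq [RHS]big_seq; apply: eq_bigr => y /fixX fix_y.
have monN := frob_norm_monic fix_y.
transitivity (\sum_(h <- monics F k.+1 | frob_norm i.+1 y %| h) G h).
  rewrite [RHS]big_mkcond; apply: eq_bigr => h _.
  by case: (_ %| h); rewrite ?mul1r ?mul0r.
(* Now [y] is fixed: [h] is its norm times a monic cofactor of degree [k - i], and both coprimality
   to [g] and the character factor accordingly. *)
rewrite sum_monics_dvd // size_frob_norm // ltn_ord subSS /G.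
under eq_bigr do rewrite coprimepMl.
case: ifP => _; last by rewrite big1.
rewrite mulr_sumr [RHS]big_mkcond /= big_seq [RHS]big_seq.
apply: eq_bigr => h; rewrite mem_monics => /andP[mon_h _].
by rewrite root_traceM // psiD.
Qed.

(** Both sequences start with 1 and satisfy the same recurrence, which determines them because
    [k.+1] is invertible. *)
Lemma Lfun_divisor_sum k : psi 0 = 1 -> Lfun E psi f g k = divisor_sum k.
Proof.
move=> psi0; elim/ltn_ind: k => -[_ | k IHk].
  rewrite /Lfun fps_exp0 /divisor_sum (perm_big [:: 1]) /=; last first.
    apply: uniq_perm; rewrite ?monics_uniq // => h; rewrite mem_monics inE.
    apply/andP/eqP => [[mon_h /size_poly1P[c _ Dh]] | ->].
      by move: mon_h; rewrite Dh monicE lead_coefC => /eqP->.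
    by rewrite monic1 size_poly1.
  rewrite big_mkcond big_seq1 coprime1p /root_trace.
  rewrite (perm_big [::]) ?big_nil; last first.
    by apply: roots_of_perm; rewrite ?monic1 // rmorph1 big_nil.
  by rewrite -(rmorph0 iota) iotaK psi0.
apply: (mulfI (x := k.+1%:R)); first by rewrite Num.Theory.pnatr_eq0.
rewrite divisor_sum_rec [LHS]fps_exp_rec //; apply: eq_bigr => i _ /=.
(* The factor from differentiation cancels the denominator in S_m / m. *)
rewrite [_ * (_ / _)]mulrC divfK ?Num.Theory.pnatr_eq0 //; congr (_ * _).
by rewrite -[LHS]/(Lfun E psi f g (k - i)) IHk // ltnS leq_subr.
Qed.

End CharacterSums.

End RationalFunction.

(** * Coprimality to g, values of the character, and the congruence *)

Lemma coprimep_all_ndvd (F : fieldType) (hs : seq {poly F}) (g h : {poly F}) :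
    g != 0 ->
    (forall Q, Q \in hs <-> [/\ Q \is monic, irreducible_poly Q & Q %| g]) ->
  coprimep h g = all (fun Q => ~~ (Q %| h)) hs.
Proof.
move=> g0 hsP; apply/idP/allP => [co_hg Q /hsP[_ irr_Q Qg] | ndvd].
  by rewrite -irreducible_poly_coprime // coprimep_sym (coprimep_dvdl Qg).
(* Strong induction on the size of a common divisor [D]: its proper divisors are constant, so a
   nonconstant [D] is irreducible, and its monic multiple lies in [hs] and divides [h]. *)
suffices no_dvd n (D : {poly F}) : (size D < n)%N -> D %| h -> D %| g -> size D == 1%N.
  by apply: (no_dvd _ (gcdp h g) (ltnSn _)); rewrite ?dvdp_gcdl ?dvdp_gcdr.
elim: n D => // n IHn D; rewrite ltnS => le_Dn Dh Dg; apply: contraT => szD.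
have D0 : D != 0 by apply: contraNneq g0 => D0; rewrite -dvd0p -D0.
have c0 : (lead_coef D)^-1 != 0 by rewrite invr_eq0 lead_coef_eq0.
pose Q := (lead_coef D)^-1 *: D.
have irr_Q : irreducible_poly Q.
  rewrite /Q; split=> [|u szu uQ].
    by rewrite size_scale // ltn_neqAle eq_sym szD size_poly_gt0.
  apply: contraR szu => ndvd_u; have uD : u %| D by rewrite -(dvdpZr _ _ c0).
  apply: IHn; rewrite ?(dvdp_trans uD) //; apply: leq_trans le_Dn.
  rewrite ltn_neqAle dvdp_leq // andbT dvdp_size_eqp //.
  by apply: contra ndvd_u; rewrite (eqp_rtrans (eqp_scale _ c0)).
have hsQ : Q \in hs.
  apply/hsP; rewrite dvdpZl // monicE lead_coefZ mulVf ?lead_coef_eq0 //.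
by have := ndvd Q hsQ; rewrite dvdpZl // Dh.
Qed.

Lemma additive_character_root (F : finFieldType) p (psi : F -> algC) x :
  p \in [pchar F] -> additive_character psi -> psi x ^+ p = 1.
Proof.
move=> charF [psi0 psiD]; have psiMn n : psi (x *+ n) = psi x ^+ n.
  by elim: n => [|n IHn]; rewrite ?mulr0n // mulrS psiD IHn exprS.
by rewrite -psiMn -mulr_natr (pcharf0 charF) mulr0.
Qed.

Theorem theorem2
    (F : finFieldType) (p : nat) (charF : p \in [pchar F])
    (zeta : algC) (zeta_prim : p.-primitive_root zeta)
    (psi : F -> algC) (psi_char : additive_character psi)
    (psi_nontriv : exists x : F, psi x != 1)
    (* the extensions F_{q^m} *)
    (E : nat -> fieldExtType F)
    (dimE : forall m : nat, (0 < m)%N -> \dim {:E m} = m)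
    (* an algebraic closure of F *)
    (K : closedFieldType) (iota : {rmorphism F -> K})
    (algK : integralRange iota)
    (f g : {poly F}) (g_neq0 : g != 0) (fg_coprime : coprimep f g)
    (pole0 : root g 0) (pole_infty : ((size g).-1 < (size f).-1)%N)
    (pole_ord : forall x : K, root (map_poly iota g) x ->
       ~~ (p %| pole_order iota f g x)%N)
    (pole_ord_infty : ~~ (p %| pole_order_infty f g)%N)
    (* the distinct roots of g in the algebraic closure *)
    (rs : seq K) (rs_uniq : uniq rs)
    (rsP : forall x : K, (x \in rs) = root (map_poly iota g) x)
    (* the distinct monic irreducible divisors of g *)
    (hs : seq {poly F}) (hs_uniq : uniq hs)
    (hsP : forall h : {poly F},
       h \in hs <-> [/\ h \is monic, irreducible_poly h & h %| g])
    (p_large : ((size f).-1 + size rs - 1 < p)%N) :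
  forall k : nat,
    eq_mod_Zadjoin zeta (1 - zeta)
      (Lfun E psi f g k)
      (\prod_(h <- hs) (1 - 'X^((size h).-1)) : {poly algC})`_k.
Proof.
move=> k; have [psi0 psiD] := psi_char.
have p_gt1 : (1 < p)%N by case/andP: charF => /prime_gt1.
rewrite (Lfun_divisor_sum iota _ _ psiD dimE) //.
(* The coefficient is taken over the integers so that it can be read both in [algC] and in [F]. *)
pose e := (\prod_(h <- hs) (1 - 'X^((size h).-1)) : {poly int})`_k.
have prod_map (R : comNzRingType) :
    (\prod_(h <- hs) (1 - 'X^((size h).-1)) : {poly R})`_k = e%:~R.
  rewrite -[RHS](coef_map intr) rmorph_prod /=; congr (nth _ (polyseq _) _).
  by apply: eq_bigr => h _; rewrite rmorphB rmorph1 /= map_polyXn.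
rewrite prod_map; pose c := count (fun h => coprimep h g) (monics F k).
(* The intermediate term is the number of monic [h] coprime to [g]: every character value is a power
   of [zeta], hence congruent to 1. *)
apply: (@eq_mod_Zadjoin_trans _ _ c%:Z%:~R).
  rewrite -[c%:Z%:~R]/(c%:R) /c -sum1_count natr_sum.
  apply: eq_mod_Zadjoin_sum => h _.
  have [i ->] := prim_rootP zeta_prim (additive_character_root
    (root_trace iota f g h) charF psi_char).
  exact: eq_mod_Zadjoin_expr.
apply: eq_mod_Zadjoin_int zeta_prim _ => //.
(* Divisibility by [p] amounts to equality in [F], where the inclusion-exclusion count applies. *)
rewrite (dvdz_pcharf charF) intrB subr_eq0 -prod_map -count_monics_ndvd //.
  by apply/eqP; congr _%:R; apply: eq_count => h; apply: coprimep_all_ndvd.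
by move=> Q /hsP[].
Qed.
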